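(* Let $\mathcal{X}$ be a complete separable metric space. Let $\mathcal{F}$ be a countable family of Borel measurable functions $f:\mathcal{X}\to\mathbb{R}$ that is uniformly bounded, i.e. there is a constant $M<\infty$ with $|f(x)|\le M$ for all $x\in\mathcal{X}$ and $f\in\mathcal{F}$. Let $\mathbf{X}=X_1,X_2,\ldots$ be a stationary ergodic process with values in $\mathcal{X}$. If the asymptotic discrepancy satisfies $\Gamma(\mathcal{F}:\mathbf{X})>\eta$ for some $\eta>0$, then $\dim_\gamma(\mathcal{F})=\infty$ for every $\gamma$ with $0<\gamma\le\eta/10$.
   Context: Discrepancy: for $m\ge1$, $\Gamma_m(\mathcal{F}:\mathbf{X})=\sup_{f\in\mathcal{F}}\left|\frac1m\sum_{i=1}^m f(X_i)-Ef(X)\right|$, where $X$ has the common (marginal) distribution of the $X_i$. For a stationary ergodic process $\mathbf{X}$ and a countable uniformly bounded family $\mathcal{F}$, there is (by the subadditive ergodic theorem) a non-negative constant $\Gamma(\mathcal{F}:\mathbf{X})$ such that $\Gamma_m(\mathcal{F}:\mathbf{X})\to\Gamma(\mathcal{F}:\mathbf{X})$ with probability one as $m\to\infty$; this constant is called the asymptotic discrepancy of $\mathcal{F}$ on $\mathbf{X}$. Gap dimension: let $\gamma>0$. The family $\mathcal{F}$ is said to $\gamma$-shatter a finite set $D\subseteq\mathcal{X}$ if there is an $\alpha\in\mathbb{R}$ such that for every $D_0\subseteq D$ there exists $f\in\mathcal{F}$ with $f(x)>\alpha+\gamma$ for $x\in D_0$ and $f(x)<\alpha-\gamma$ for $x\in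 D\setminus D_0$. The gap dimension $\dim_\gamma(\mathcal{F})$ is the largest $k$ such that $\mathcal{F}$ $\gamma$-shatters some set of cardinality $k$; if $\mathcal{F}$ $\gamma$-shatters sets of arbitrarily large finite cardinality, then $\dim_\gamma(\mathcal{F})=+\infty$. *)

(* Defs.v *)
From HB Require Import structures.
From mathcomp Require Import all_boot all_order all_algebra.
From mathcomp Require Import all_classical all_reals all_analysis.

Set Implicit Arguments.
Unset Strict Implicit.
Unset Printing Implicit Defensive.

Import Order.TTheory GRing.Theory Num.Theory.
Import numFieldNormedType.Exports.

Local Open Scope classical_set_scope.
Local Open Scope ring_scope.

(* Complete metric spaces. Completeness of uniform spaces in the library comes
   with a base point; a space carrying a process is nonempty anyway. *)
#[short(type="completeMetricType")]
HB.structure Definition CompleteMetric (R : numDomainType) :=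
  {T of Metric R T & Complete T}.

Definition separable (T : topologicalType) :=
  exists2 D : set T, countable D & dense D.

Notation borel T := (g_sigma_algebraType (@open T)).

Section process.
Context d d' (Omega : measurableType d) (T : measurableType d') (R : realType).
Variables (P : probability Omega R) (X : nat -> {RV P >-> T}).

(* The product sigma-algebra on the space of one-sided sequences. *)
Definition path_measurable : set (set (nat -> T)) :=
  <<s [set B | exists i : nat,
         exists2 A : set T, measurable A & B = [set x | A (x i)] ]>>.

Definition left_shift (x : nat -> T) : nat -> T := fun i => x i.+1.

Definition trajectory (w : Omega) : nat -> T := fun i => X i w.

Definition stationary := forall B, path_measurable B ->
  P (trajectory @^-1` (left_shift @^-1` B)) = P (trajectory @^-1` B).

Definition ergodic := forall B, path_measurable B -> left_shift @^-1` B = B ->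
  P (trajectory @^-1` B) = 0%E \/ P (trajectory @^-1` B) = 1%E.

(* The process is indexed from 0. *)
Definition discrepancy (F : set (T -> R)) (m : nat) (w : Omega) : R :=
  sup [set `| m%:R^-1 * (\sum_(i < m) f (X i w)) - fine 'E_P[f \o X 0%N] |
      | f in F].

Definition is_asymptotic_discrepancy (F : set (T -> R)) (c : R) :=
  {ae P, forall w, discrepancy F m w @[m --> \oo] --> c}.

(* The almost sure limit of the discrepancies; the dummy value 0 is only used
   if there is none. *)
Definition asymptotic_discrepancy (F : set (T -> R)) : R :=
  xget 0 [set c | is_asymptotic_discrepancy F c].

Lemma asymptotic_discrepancyE (F : set (T -> R)) (c : R) :
  is_asymptotic_discrepancy F c -> asymptotic_discrepancy F = c.
Proof.
move=> Fc; rewrite /asymptotic_discrepancy.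
case: xgetP => [c' _ Fc'|/(_ c)//].
have : (almost_everywhere P) (fun w => discrepancy F m w @[m --> \oo] --> c /\
                                    discrepancy F m w @[m --> \oo] --> c').
  exact: filterI Fc Fc'.
have PT : (0 < P setT)%E by rewrite probability_setT lte01.
have := ae_properfilter_algebraOfSetsType PT => ? /filter_ex[w [wc wc']].
exact: cvg_unique wc' wc.
Qed.

End process.

Arguments stationary {d d' Omega T R} P X.
Arguments ergodic {d d' Omega T R} P X.
Arguments discrepancy {d d' Omega T R} P X F m w.
Arguments is_asymptotic_discrepancy {d d' Omega T R} P X F c.
Arguments asymptotic_discrepancy {d d' Omega T R} P X F.

Section gap_dimension.
Context (T : Type) (R : realType).

Definition shatters (gamma : R) (F : set (T -> R)) (D : set T) :=
  exists alpha : R, forall D0 : set T, D0 `<=` D ->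
    exists2 f, F f & (forall x, D0 x -> alpha + gamma < f x) /\
                     (forall x, (D `\` D0) x -> f x < alpha - gamma).

Definition gap_dim (gamma : R) (F : set (T -> R)) : \bar R :=
  ereal_sup [set k%:R%:E | k in
    [set k : nat | exists2 D : set T, (D #= `I_k)%card & shatters gamma F D]].

End gap_dimension.

(* Main.v *)
(** Let [lam] be the law of [X 0]. Along an ultrafilter of pairs (w, m) at which
    the discrepancy exceeds [eta], choose f in [F] whose empirical mean and
    expectation differ by more than [eta]. By the ergodic theorem, the limits of
    the two set functions
      A |-> m^-1 * sum_(i < m) f(X_i) 1_A(X_i)   and   A |-> E[f(X_0) 1_A(X_0)]
    along the ultrafilter are dominated by a multiple of [lam], so they have
    densities [g] and [g'], whose integrals differ by at least [eta]. Hence on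
    some set [B] of positive measure one of them exceeds a level [alpha] and the
    other one is below it, with room to spare. If A is a nonnull subset of
    [B], then, along the ultrafilter, f exceeds [alpha + gamma] somewhere on A
    and is below [alpha - gamma] somewhere on A; both parts of A are nonnull,
    because almost every trajectory avoids any given countable family of null
    sets. So functions can be chosen one after the other, each splitting all the
    cells cut out of [B] by the previous ones, and [2 ^ L] functions with all
    their cells nonempty shatter [L] points. *)

Require Import Defs.
From HB Require Import structures.
From mathcomp Require Import all_boot all_order all_algebra.
From mathcomp Require Import all_classical all_reals all_analysis.
From mathcomp Require Import measurable_realfun lra.

Set Implicit Arguments.
Unset Strict Implicit.
Unset Printing Implicit Defensive.

Import Order.TTheory GRing.Theory Num.Theory.
Import numFieldNormedType.Exports.
Local Open Scope classical_set_scope.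
Local Open Scope ring_scope.

(** * The maximal ergodic inequality *)

Section integral_complements.
Context {d} {T : measurableType d} {R : realType}.

Lemma measurable_superlevel (f : T -> R) (c : R) :
  measurable_fun setT f -> measurable [set x | c < f x].
Proof.
move=> mf.
rewrite (_ : [set _ | _] = setT `&` f @^-1` `]c, +oo[); first exact: mf.
by rewrite setTI; apply/seteqP; split => x /=; rewrite in_itv/= andbT.
Qed.

Lemma measurable_sublevel (f : T -> R) (c : R) :
  measurable_fun setT f -> measurable [set x | f x < c].
Proof.
move=> mf.
rewrite (_ : [set _ | _] = setT `&` f @^-1` `]-oo, c[); first exact: mf.
by rewrite setTI; apply/seteqP; split => x /=; rewrite in_itv/=.
Qed.

Lemma bounded_integrable (mu : {finite_measure set T -> \bar R}) (A : set T)
    (f : T -> R) (K : R) :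
  measurable A -> measurable_fun setT f -> (forall x, `|f x| <= K) ->
  mu.-integrable A (EFin \o f).
Proof.
move=> mA mf fK; apply: measurable_bounded_integrable => //.
- by rewrite ltey_eq fin_num_measure.
- exact: measurable_funTS.
- exists K; split; first exact: num_real.
  by move=> y Ky x _; exact: le_trans (fK x) (ltW Ky).
Qed.

Lemma Rintegral_measure_preserving (mu : {finite_measure set T -> \bar R})
    (theta : {mfun T >-> T}) (f : T -> R) (K : R) :
  (forall B, measurable B -> mu (theta @^-1` B) = mu B) ->
  measurable_fun setT f -> (forall x, `|f x| <= K) ->
  \int[mu]_x f (theta x) = \int[mu]_x f x.
Proof.
move=> mu_theta mf fK; congr fine.
transitivity (\int[pushforward mu theta]_x (f x)%:E)%E.
  rewrite integral_pushforward ?preimage_setT//.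
  - exact/measurable_EFinP.
  - apply: (@bounded_integrable mu setT (f \o theta) K) => //.
      exact: measurableT_comp.
    by move=> x; exact: fK.
apply: eq_measure_integral => A mA _; exact: mu_theta.
Qed.

End integral_complements.

Section maximal_ergodic.
Context {d} {T : measurableType d} {R : realType}.
Variables (mu : probability T R) (theta : {mfun T >-> T}).
Hypothesis mu_theta : forall B, measurable B -> mu (theta @^-1` B) = mu B.
Variables (phi : T -> R) (K : R).
Hypotheses (mphi : measurable_fun setT phi) (phiK : forall x, `|phi x| <= K).

Definition birkhoff_sum (n : nat) (x : T) : R :=
  \sum_(i < n) phi (iter i theta x).

(* Satisfies [max_birkhoff_sum n x = max_(k <= n) birkhoff_sum k x]. *)
Fixpoint max_birkhoff_sum (n : nat) (x : T) : R :=
  if n is m.+1 then Num.max 0 (phi x + max_birkhoff_sum m (theta x)) else 0.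

Lemma birkhoff_sumS n x :
  birkhoff_sum n.+1 x = phi x + birkhoff_sum n (theta x).
Proof.
rewrite /birkhoff_sum big_ord_recl; congr (_ + _).
by apply: eq_bigr => i _; rewrite -iterSr.
Qed.

Lemma measurable_birkhoff_sum n : measurable_fun setT (birkhoff_sum n).
Proof.
elim: n => [|n IHn].
  have -> : birkhoff_sum 0 = cst 0.
    by apply/funext => x; rewrite /birkhoff_sum big_ord0.
  exact: measurable_cst.
have -> : birkhoff_sum n.+1 = fun x => phi x + birkhoff_sum n (theta x).
  by apply/funext => x; rewrite birkhoff_sumS.
by apply: measurable_funD => //; exact: measurableT_comp.
Qed.

Lemma measurable_max_birkhoff_sum n : measurable_fun setT (max_birkhoff_sum n).
Proof.
elim: n => [|n IHn]; first exact: measurable_cst.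
apply: measurable_maxr => //; apply: measurable_funD => //.
exact: measurableT_comp.
Qed.

Lemma max_birkhoff_sum_ge0 n x : 0 <= max_birkhoff_sum n x.
Proof. by case: n => // n /=; rewrite le_max lexx. Qed.

Lemma le_max_birkhoff_sum n x : max_birkhoff_sum n x <= max_birkhoff_sum n.+1 x.
Proof.
elim: n x => [x|n IHn x]; first exact: max_birkhoff_sum_ge0.
rewrite [leLHS]/= [leRHS]/= ge_max !le_max lexx/=.
by apply/orP; right; rewrite lerD2l; exact: IHn.
Qed.

Lemma birkhoff_sum_le_max n x : birkhoff_sum n x <= max_birkhoff_sum n x.
Proof.
elim: n x => [|n IHn] x; first by rewrite /birkhoff_sum big_ord0.
by rewrite birkhoff_sumS le_max lerD2l IHn orbT.
Qed.

Lemma max_birkhoff_sum_bounded n x : `|max_birkhoff_sum n x| <= n%:R * K.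
Proof.
rewrite ger0_norm ?max_birkhoff_sum_ge0//.
have K0 : 0 <= K by exact: le_trans (phiK x).
elim: n x => [|n IHn] x /=; first by rewrite mul0r.
rewrite ge_max mulr_ge0//= mulrS mulrDl mul1r lerD//.
exact: le_trans (ler_norm _) _.
Qed.

(* Garsia's proof: on the set of integration, [phi] dominates the coboundary
   [M - M \o theta], whose integral vanishes; outside of it the coboundary is
   nonpositive. *)
Lemma maximal_ergodic n :
  0 <= \int[mu]_(x in [set x | 0 < max_birkhoff_sum n x]) phi x.
Proof.
set M := max_birkhoff_sum n; set A := [set x | _].
have mM : measurable_fun setT M := measurable_max_birkhoff_sum n.
have MK x : `|M x| <= n%:R * K := max_birkhoff_sum_bounded n x.
have mA : measurable A.
  exact: measurable_superlevel.
have iM : mu.-integrable setT (EFin \o M) by exact: bounded_integrable MK.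
have iMt : mu.-integrable setT (EFin \o (M \o theta)).
  apply: (@bounded_integrable _ _ _ _ _ _ (n%:R * K)) => // [|x].
    exact: measurableT_comp.
  exact: MK.
have <- : \int[mu]_x (M x - M (theta x)) = 0.
  by rewrite RintegralB// (Rintegral_measure_preserving mu_theta mM MK) subrr.
rewrite [leRHS]Rintegral_mkcond; apply: le_Rintegral => //.
- exact: (integrableB _ iM iMt).
- have := @bounded_integrable _ _ _ mu A phi K mA mphi phiK.
  by move=> /(integrable_mkcond _ mA); rewrite restrict_EFin.
move=> x _; rewrite patchE; case: ifPn => [|/negP]; rewrite inE /A /=.
  (* Since [M] vanishes for [n = 0], here [n = m.+1], and a positive maximum is attained by its
     second argument. Raising [m] to [m.+1] at [theta x] can only increase it, which gives
     [M x <= phi x + M (theta x)]. *)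
  rewrite /M; move: (n) => [|m]; rewrite ?ltxx// => M0.
  rewrite lerBlDr.
  have -> : max_birkhoff_sum m.+1 x = phi x + max_birkhoff_sum m (theta x).
    by move: M0 => /=; rewrite lt_max ltxx/= => /ltW/max_idPr.
  by rewrite lerD2l le_max_birkhoff_sum.
move=> /negP; rewrite -leNgt => M0; rewrite subr_le0.
exact: le_trans M0 (max_birkhoff_sum_ge0 _ _).
Qed.

Hypothesis erg : forall B, measurable B -> theta @^-1` B = B ->
  mu B = 0%E \/ mu B = 1%E.

(* The set where the sums are unbounded is exactly invariant; by the maximal
   inequality it cannot have full measure. *)
Lemma birkhoff_sum_bounded_above : \int[mu]_x phi x < 0 ->
  {ae mu, forall x, exists k : nat, forall n, birkhoff_sum n x <= k%:R}.
Proof.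
move=> phi_lt0.
pose G := \bigcap_(k in setT) \bigcup_(n in setT)
  [set x | k%:R < birkhoff_sum n x].
have mG : measurable G.
  apply: bigcapT_measurable => k; apply: bigcupT_measurable => n.
  exact/measurable_superlevel/measurable_birkhoff_sum.
(* The sums at [x] and at [theta x] differ by [phi x], hence by at most [k0]. So exceeding level
   [k + k0] from one starting point forces exceeding level [k] from the other. *)
have GE : theta @^-1` G = G.
  have [k0 Kk0] : exists k0 : nat, K <= k0%:R.
    by exists (Num.truncn K).+1; rewrite ltW// truncnS_gt.
  apply/seteqP; split => x /= Gx k _.
    have [n _ /= kn] := Gx (k + k0)%N I.
    exists n.+1 => //=; rewrite birkhoff_sumS.
    rewrite natrD in kn; have := phiK x; rewrite ler_norml => /andP[phi1 _].
    lra.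
  have [[|n] _ /=] := Gx (k + k0)%N I.
    by rewrite /birkhoff_sum big_ord0 ltrn0.
  rewrite birkhoff_sumS => kn; exists n => //=.
  rewrite natrD in kn; have := phiK x; rewrite ler_norml => /andP[_ phi1].
  lra.
have [G0|G1] := erg mG GE.
  exists G; split => // x /= Gx k _; apply: contrapT => nGx.
  apply: Gx; exists k => n; rewrite leNgt; apply/negP => kn; apply: nGx.
  by exists n.
exfalso.
pose A n := [set x | 0 < max_birkhoff_sum n x].
have mA n : measurable (A n).
  exact/measurable_superlevel/measurable_max_birkhoff_sum.
(* Level 0 in the definition of [G] already yields a positive sum, so the sets [A n] cover [G]. *)
have A1 : mu (\bigcup_n A n) = 1%E.
  have mUA : measurable (\bigcup_n A n) by exact: bigcupT_measurable.
  apply: le_anti; rewrite probability_le1//= -G1 le_measure// ?inE//.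
  move=> x /(_ 0%N I)[n _ /= n0]; exists n => //.
  exact: lt_le_trans n0 (birkhoff_sum_le_max _ _).
have : mu (A n) @[n --> \oo] --> 1%E.
  rewrite -A1; apply: nondecreasing_cvg_mu => //.
    exact: bigcupT_measurable.
  apply/nondecreasing_seqP => n; apply/subsetPset => x /=.
  by move=> /lt_le_trans; apply; exact: le_max_birkhoff_sum.
(* Once [1 - mu (A n) < e], the integral of [phi] is at least [- (K * e)], which this choice of [e]
   rules out. Dividing by [K + 1] rather than [K] covers [K = 0]. *)
have [e [e0 Ke]] : exists e : R, 0 < e /\ K * e < - \int[mu]_x phi x.
  have K0 : 0 <= K := le_trans (normr_ge0 _) (phiK point).
  have K1 : 0 < K + 1 by rewrite ltr_wpDl.
  exists (- (\int[mu]_x phi x) / (K + 1)); split.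
    by rewrite divr_gt0// oppr_gt0.
  rewrite mulrA ltr_pdivrMr// mulrC ltr_pM2l ?oppr_gt0// ltrDl//.
move=> /fine_cvgP[_ /cvgrPdist_lt/(_ e e0)[n _ /(_ n (leqnn n))]] /=.
rewrite distrC ltr_norml => /andP[+ _].
suff : - (K * (1 - fine (mu (A n)))) <= \int[mu]_x phi x.
  move=> h1 h2; have K0 : 0 <= K := le_trans (normr_ge0 _) (phiK point).
  have : K * (1 - fine (mu (A n))) <= K * e.
    by rewrite ler_wpM2l//; lra.
  lra.
have mAC : measurable (~` A n) by exact: measurableC.
have iphi (B : set T) : measurable B -> mu.-integrable B (EFin \o phi).
  by move=> mB; exact: bounded_integrable phiK.
rewrite -(setUv (A n)) Rintegral_setU//; last 2 first.
- by rewrite setUv; exact: iphi.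
- by apply/disj_setPCl.
(* The integral over [A n] is nonnegative by the maximal inequality; on the complement only
   [phi >= - K] is used. *)
apply: le_trans (lerD (maximal_ergodic n) (lexx _)); rewrite add0r.
have -> : - (K * (1 - fine (mu (A n)))) = \int[mu]_(x in ~` A n) (- K).
  rewrite Rintegral_cst// mulNr; congr (- (K * _)).
  transitivity (fine (1 - mu (A n))%E).
    by rewrite fineB// fin_num_measure.
  by congr fine; apply/esym; exact: probability_setC.
apply: le_Rintegral => //; [|exact: iphi|].
  apply: (@bounded_integrable _ _ _ _ _ _ `|K|) => // x.
  by rewrite normrN.
by move=> x _; have := phiK x; rewrite ler_norml => /andP[].
Qed.

End maximal_ergodic.

(** * The ergodic theorem for stationary ergodic processes *)

Section birkhoff_process.
Context {d d'} {Omega : measurableType d} {T : measurableType d'}.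
Context {R : realType}.
Variables (P : probability Omega R) (X : nat -> {RV P >-> T}).

(** This is the generating family of [path_measurable], so measurability on [path] unfolds to
    [path_measurable], and stationarity and ergodicity apply directly to events of the path
    space. *)
Definition cylinders : set (set (nat -> T)) :=
  [set B | exists i : nat,
     exists2 A : set T, measurable A & B = [set x | A (x i)] ].

Local Notation path := (g_sigma_algebraType cylinders).

Lemma measurable_coordinate i : measurable_fun setT (fun x : path => x i).
Proof.
move=> _ A mA; rewrite setTI; apply: sub_sigma_algebra.
by exists i, A.
Qed.

Lemma measurable_left_shift :
  measurable_fun setT (@left_shift _ T : path -> path).
Proof.
apply: (@measurability _ _ _ path _ _ cylinders) => // _ [_ [i [A mA ->]] <-].
rewrite setTI.
by apply: sub_sigma_algebra; exists i.+1, A.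
Qed.

Lemma measurable_trajectory :
  measurable_fun setT (trajectory X : Omega -> path).
Proof.
apply: (@measurability _ _ _ path _ _ cylinders) => // _ [_ [i [A mA ->]] <-].
have mXi : measurable_fun setT (X i) by [].
exact: (mXi measurableT A mA).
Qed.

Let trajectory_mixin :=
  @isMeasurableFun.Build _ _ Omega path (trajectory X) measurable_trajectory.
Let traj : {mfun Omega >-> path} :=
  HB.pack (trajectory X : Omega -> path) trajectory_mixin.

Let left_shift_mixin :=
  @isMeasurableFun.Build _ _ path path (@left_shift _ T) measurable_left_shift.
Let shift : {mfun path >-> path} :=
  HB.pack (@left_shift _ T : path -> path) left_shift_mixin.

Hypotheses (stationaryX : stationary P X) (ergodicX : ergodic P X).

Lemma stationary_distribution i (A : set T) : measurable A ->
  P (X i @^-1` A) = P (X 0%N @^-1` A).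
Proof.
move=> mA; elim: i => // i <-.
have := @stationaryX [set x | A (x i)]; apply.
by apply: sub_sigma_algebra; exists i, A.
Qed.

(** For [c'] midway between the expectation and [c], the function [h - c'] has negative mean, so its
    sums along almost every path stay below some [k]. The averages of [h] are then at most
    [c' + k / m], which is below [c] for large [m]. *)
Lemma birkhoff_upper (h : T -> R) (K c : R) :
  measurable_fun setT h -> (forall x, `|h x| <= K) ->
  \int[P]_w h (X 0%N w) < c ->
  {ae P, forall w,
    \forall m \near \oo, m%:R^-1 * (\sum_(i < m) h (X i w)) < c}.
Proof.
move=> mh hK Ehc.
pose mu : probability path R := distribution P traj.
pose c' := (\int[P]_w h (X 0%N w) + c) / 2.
pose psi (x : path) := h (x 0%N) - c'.
have mpsi : measurable_fun setT psi.
  apply: measurable_funB => //; apply: measurableT_comp => //.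
  exact: measurable_coordinate.
have psiK x : `|psi x| <= K + `|c'|.
  by rewrite (le_trans (ler_normB _ _))// lerD.
have psi0 : \int[mu]_x psi x < 0.
  have -> : \int[mu]_x psi x = \int[P]_w (h (X 0%N w) - c').
    congr fine; rewrite integral_pushforward ?preimage_setT//.
    - exact/measurable_EFinP.
    - apply: (@bounded_integrable _ _ _ P setT (psi \o traj) (K + `|c'|)) => //.
        exact: measurableT_comp.
      by move=> x; exact: psiK.
  have iX : P.-integrable setT (EFin \o (h \o X 0%N)).
    apply: (@bounded_integrable _ _ _ P setT (h \o X 0%N) K) => //.
      exact: measurableT_comp.
    by move=> x; exact: hK.
  rewrite RintegralB//.
    rewrite Rintegral_cst// -[X in _ - _ * fine X]/(P setT) probability_setT/=.
    rewrite mulr1 /c'; lra.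
  apply: (@bounded_integrable _ _ _ _ _ _ `|c'|) => //.
have mu_shift (B : set path) : measurable B -> mu (shift @^-1` B) = mu B.
  by move=> mB; exact: stationaryX.
have erg (B : set path) : measurable B -> shift @^-1` B = B ->
    mu B = 0%E \/ mu B = 1%E.
  by move=> mB; exact: ergodicX.
have [N [mN N0 sN]] := birkhoff_sum_bounded_above mu_shift mpsi psiK erg psi0.
exists (trajectory X @^-1` N); split => //.
  by rewrite -[X in measurable X]setTI; exact: measurable_trajectory.
move=> w /= nw; apply: sN => /= -[k bk]; apply: nw.
have iter_shift i (x : path) : iter i shift x 0%N = x i.
  suff : forall j, iter i shift x j = x (j + i)%N by move=> /(_ 0%N).
  elim: i => [|i IHi] j; first by rewrite addn0.
  by rewrite iterS -[LHS]/(iter i shift x j.+1) IHi addSnnS.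
have Sk n : \sum_(i < n) h (X i w) <= k%:R + n%:R * c'.
  rewrite -lerBlDr; apply: le_trans (bk n); rewrite /birkhoff_sum.
  rewrite [leRHS](eq_bigr (fun i : 'I_n => h (X i w) - c')).
    by rewrite big_split/= sumr_const card_ord mulNrn mulr_natl.
  by move=> i _; rewrite /psi; congr (h _ - _); exact: iter_shift.
have cc' : 0 < c - c' by rewrite /c'; lra.
(* Beyond this threshold [k / n < c - c']. *)
exists (Num.truncn (k%:R / (c - c'))).+1 => // n /= kn.
have n0 : 0 < n%:R :> R by rewrite ltr0n (leq_trans _ kn).
rewrite ltr_pdivrMl//; apply: le_lt_trans (Sk n) _.
rewrite -ltrBrDr -mulrBr -ltr_pdivrMr//.
by rewrite (lt_le_trans (truncnS_gt _))// ler_nat.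
Qed.

Lemma birkhoff_process (h : T -> R) (K : R) :
  measurable_fun setT h -> (forall x, `|h x| <= K) -> forall e : R, 0 < e ->
  {ae P, forall w, \forall m \near \oo,
    `|m%:R^-1 * (\sum_(i < m) h (X i w)) - \int[P]_w h (X 0%N w)| < e}.
Proof.
move=> mh hK e e0; set E := \int[P]_w _.
have upper : E < E + e by rewrite ltrDl.
have lower : \int[P]_w - h (X 0%N w) < - E + e.
  have -> : \int[P]_w - h (X 0%N w) = - E; last by rewrite ltrDl.
  under eq_Rintegral do rewrite -mulN1r.
  rewrite RintegralZl ?mulN1r//.
  apply: (@bounded_integrable _ _ _ P setT (h \o X 0%N) K) => //.
    exact: measurableT_comp.
  by move=> x; exact: hK.
have NhK x : `|- h x| <= K by rewrite normrN.
have mNh : measurable_fun setT (fun x => - h x) by exact: measurableT_comp.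
apply: filterS2 (birkhoff_upper mh hK upper) (birkhoff_upper mNh NhK lower).
move=> w up low; near=> m.
rewrite ltr_norml; apply/andP; split; last by rewrite ltrBlDl; near: m.
rewrite ltrBrDl -ltrN2 opprD opprK -mulrN -sumrN; near: m.
exact: low.
Unshelve. all: by end_near. Qed.

End birkhoff_process.

(** * Densities of limits along ultrafilters *)

(** The image of [U] has a cluster point in the compact segment from [- K] to [K], and a cluster
    point of an ultrafilter is a limit. *)
Lemma ultra_bounded_cvg (R : realType) (I : Type) (U : set_system I)
    (g : I -> R) (K : R) :
  UltraFilter U -> (forall p, `|g p| <= K) -> cvg (g @ U).
Proof.
move=> UU gK.
have [|l [_ gl]] := @segment_compact R (- K) K (g @ U) _.
  by apply: (@filterE _ U) => p /=; rewrite in_itv/= -ler_norml.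
apply/cvg_ex; exists l => V Vl.
have [//|UV] := in_ultra_setVsetC (g @^-1` V) UU.
by have [x [/= ? ?]] := gl (~` V) V UV Vl.
Qed.

Section density.
Context {d} {T : measurableType d} {R : realType}.
Variables (lam : probability T R) (v : set T -> R) (K : R).
Hypothesis v_additive : forall A B, measurable A -> measurable B ->
  A `&` B = set0 -> v (A `|` B) = v A + v B.
Hypothesis v_dominated : forall A, measurable A -> `|v A| <= K * fine (lam A).

Let nu (A : set T) : \bar R := (v A)%:E.

Let v0 : v set0 = 0.
Proof.
by apply/eqP; rewrite -normr_le0 (le_trans (v_dominated _))// measure0 mulr0.
Qed.

(** Domination upgrades finite additivity to countable additivity: the value of [v] on the remainder
    [B] minus [S m] is at most [K] times its [lam]-measure, which tends to 0 by continuity of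
    [lam]. *)
Let nu_sigma_additive : semi_sigma_additive nu.
Proof.
move=> F mF tF mUF.
pose S m := \big[setU/set0]_(i < m) F i.
have mS m : measurable (S m) by exact: bigsetU_measurable.
have nuS : (fun m => \sum_(0 <= i < m) nu (F i))%E = (fun m => (v (S m))%:E).
  apply/funext => m; rewrite /S; elim: m => [|m IHm].
    by rewrite big_geq// big_ord0 v0.
  rewrite big_nat_recr//= IHm big_ord_recr/= v_additive//; first exact: mS.
  rewrite -bigcup_mkord -subset0 => x [[i /= im Fi] Fm].
  have := tF i m I I (ex_intro _ x (conj Fi Fm)).
  by move=> im'; rewrite im' ltnn in im.
rewrite nuS; apply: cvg_EFin; first exact: nearW.
have Slam : fine (lam (S m)) @[m --> \oo] --> fine (lam (\bigcup_i F i)).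
  apply: fine_cvg; rewrite fineK ?fin_num_measure//.
  have <- : \bigcup_m S m = \bigcup_i F i.
    apply/seteqP; split => x [i _].
      by rewrite /S -bigcup_mkord => -[j _ Fj]; exists j.
    by move=> Fi; exists i.+1 => //; rewrite /S big_ord_recr/=; right.
  apply: nondecreasing_cvg_mu => //; first exact: bigcupT_measurable.
  apply/nondecreasing_seqP => m; apply/subsetPset; rewrite /S big_ord_recr/=.
  exact: subsetUl.
pose B := \bigcup_i F i; have mB : measurable B by [].
have rest m : `|v B - v (S m)| <= K * (fine (lam B) - fine (lam (S m))).
  have SU : S m `<=` B.
    by rewrite /S /B -bigcup_mkord => x [i _ Fi]; exists i.
  have mD : measurable (B `\` S m) by exact: measurableD.
  have UE : B = S m `|` (B `\` S m) by rewrite setDUK.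
  have disj : S m `&` (B `\` S m) = set0 by rewrite setDIK.
  rewrite {1}UE v_additive// addrAC subrr add0r.
  apply: le_trans (v_dominated mD) _.
  by rewrite {2}UE measureU// fineD ?fin_num_measure// addrAC subrr add0r.
apply/cvgrPdist_le => e e0.
have K0 : 0 <= K.
  have := v_dominated (@measurableT _ T); rewrite probability_setT mulr1.
  exact: le_trans.
have K1 : 0 < K + 1 by rewrite ltr_wpDl.
have eK : 0 < e / (K + 1) by rewrite divr_gt0.
move/cvgrPdist_le : Slam => /(_ _ eK); apply: filterS => m /= Sm.
apply: le_trans (rest m) _.
apply: (@le_trans _ _ (K * (e / (K + 1)))).
  by rewrite ler_wpM2l// (le_trans (ler_norm _)).
by rewrite mulrA ler_pdivrMr// mulrC ler_pM2l// lerDl.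
Qed.

Let nu_mixin := isCharge.Build _ T R nu (congr1 EFin v0) (fun _ _ => erefl)
  nu_sigma_additive.
Let nuc : {charge set T -> \bar R} := HB.pack nu nu_mixin.

Lemma dominated_density : exists2 g : T -> R, lam.-integrable setT (EFin \o g) &
  forall A, measurable A -> v A = \int[lam]_(x in A) g x.
Proof.
have nulam : nuc `<< lam.
  apply/null_content_dominatesP => A mA lamA0.
  have : `|v A| <= 0 by rewrite (le_trans (v_dominated mA))// lamA0 mulr0.
  by rewrite normr_le0 => /eqP nA; rewrite /= /nu nA.
exists (fine \o Radon_Nikodym nuc lam).
  apply: eq_integrable (Radon_Nikodym_integrable nulam) => // x _ /=.
  by rewrite fineK// Radon_Nikodym_fin_num.
move=> A mA.
rewrite -[v A]/(fine (nuc A)) (Radon_Nikodym_integral nulam mA).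
congr fine; apply: eq_integral => x _ /=.
by rewrite fineK// Radon_Nikodym_fin_num.
Qed.

End density.

(** * Limit densities and levels separating two of them *)

Section splitting.
Context {d} {T : measurableType d} {R : realType}.
Variable lam : probability T R.

(** For a single [p], the bound is only in terms of [w p], which may be an empirical measure
    singular to [lam]. Domination by [lam] appears in the limit, where finite additivity survives as
    well, and Radon-Nikodym then applies. *)
Lemma limit_density (I : Type) (U : set_system I) (J w : I -> set T -> R)
    (K : R) : UltraFilter U -> 0 <= K ->
  (forall p A B, measurable A -> measurable B -> A `&` B = set0 ->
    J p (A `|` B) = J p A + J p B) ->
  (forall p A, measurable A -> `|J p A| <= K * w p A) ->
  (forall p A, measurable A -> w p A <= 1) ->
  (forall A, measurable A -> w p A @[p --> U] --> fine (lam A)) ->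
  exists2 g : T -> R, lam.-integrable setT (EFin \o g) &
    forall A, measurable A -> J p A @[p --> U] --> \int[lam]_(x in A) g x.
Proof.
move=> UU K0 JD JK w1 wlam.
have cvgJ A : measurable A -> cvg (J p A @[p --> U]).
  move=> mA; apply: (@ultra_bounded_cvg _ _ _ _ K) => p.
  by rewrite (le_trans (JK p A mA))// ler_piMr// w1.
have [||g ig gJ] := @dominated_density _ _ _ lam
    (fun A => lim (J p A @[p --> U])) K.
- move=> A B mA mB AB; rewrite -limD; [|exact: cvgJ..].
  by under eq_fun do rewrite JD//.
- move=> A mA; rewrite -subr_ge0.
  have h : K * w p A - `|J p A| @[p --> U] -->
      K * fine (lam A) - `|lim (J p A @[p --> U])|.
    apply: cvgB; first by apply: cvgMl_tmp; exact: wlam.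
    by apply: cvg_norm; exact: cvgJ.
  rewrite -(cvg_lim _ h)//; apply: limr_ge; first exact: cvgP h.
  by apply: nearW => p; rewrite subr_ge0; exact: JK.
by exists g => // A mA; rewrite -gJ//; exact: cvgJ.
Qed.

(** If for every rational [q] the set where [g2 + delta < q < g1 - delta] were null, then [g1 - g2]
    would be at most [2 * delta] almost everywhere, and so would its integral. Rational levels keep
    the union of null sets countable. *)
Lemma exists_gap_level (g1 g2 : T -> R) (delta : R) :
  lam.-integrable setT (EFin \o g1) -> lam.-integrable setT (EFin \o g2) ->
  2 * delta < \int[lam]_x g1 x - \int[lam]_x g2 x ->
  exists (alpha : R) (B : set T), [/\ measurable B, (0 < lam B)%E,
    forall x, B x -> alpha + delta <= g1 x &
    forall x, B x -> g2 x <= alpha - delta].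
Proof.
move=> ig1 ig2 dg; apply: contrapT => noB.
have mg1 : measurable_fun setT g1.
  by apply/measurable_EFinP; exact: measurable_int ig1.
have mg2 : measurable_fun setT g2.
  by apply/measurable_EFinP; exact: measurable_int ig2.
pose B (q : rat) :=
  [set x | ratr q + delta < g1 x] `&` [set x | g2 x < ratr q - delta].
have mB q : measurable (B q).
  apply: measurableI; first exact: measurable_superlevel.
  exact: measurable_sublevel.
have B0 q : lam (B q) = 0%E.
  apply: contrapT => /eqP Bq; apply: noB; exists (ratr q), (B q); split => //.
  - by rewrite lt0e Bq measure_ge0.
  - by move=> x [/ltW].
  - by move=> x [_ /ltW].
(* Numbers that code no rational default to level 0, whose set is null like the others. *)
pose N := \bigcup_n B (odflt 0 (unpickle n)).
have mN : measurable N by exact: bigcupT_measurable.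
have N0 : lam N = 0%E.
  apply/(negligibleP _ mN); apply: negligible_bigcup => n.
  by apply/(negligibleP _ (mB _)); exact: B0.
have le2 x : ~ N x -> g1 x - g2 x <= 2 * delta.
  move=> Nx; rewrite leNgt; apply/negP => gx; apply: Nx.
  have [|q] := @rat_in_itvoo R (g2 x + delta) (g1 x - delta); first lra.
  rewrite in_itv/= => /andP[q2 q1]; exists (pickle q) => //.
  by rewrite pickleK/=; split => /=; lra.
have ig12 : lam.-integrable setT (EFin \o (fun x => g1 x - g2 x)).
  exact: (integrableB _ ig1 ig2).
move: dg; rewrite -RintegralB//; apply/negP; rewrite -leNgt.
have -> : \int[lam]_x (g1 x - g2 x) = \int[lam]_(x in ~` N) (g1 x - g2 x).
  by congr fine; rewrite -setTD; exact: negligible_integral.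
have mNC : measurable (~` N) by exact: measurableC.
have -> : 2 * delta = \int[lam]_(x in ~` N) (2 * delta).
  rewrite Rintegral_cst//.
  suff -> : fine (lam (~` N)) = 1 by rewrite mulr1.
  transitivity (fine (1 - lam N)%E); first congr fine.
    exact: probability_setC.
  by rewrite N0 sube0.
apply: le_Rintegral => //; first exact: integrableS ig12.
exact: (@bounded_integrable _ _ _ lam _ (cst (2 * delta)) `|2 * delta|).
Qed.

(** The limit of [J p A - c * w p A] is at least [(c' - c) * lam A], which is positive, so the
    difference is eventually positive along [U]. *)
Lemma eventually_gt_of_density (I : Type) (U : set_system I)
    (J w : I -> set T -> R) (g : T -> R) (A : set T) (c c' : R) :
  Filter U -> measurable A ->
  lam.-integrable setT (EFin \o g) ->
  J p A @[p --> U] --> \int[lam]_(x in A) g x ->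
  w p A @[p --> U] --> fine (lam A) ->
  (0 < lam A)%E -> c < c' -> (forall x, A x -> c' <= g x) ->
  \forall p \near U, c * w p A < J p A.
Proof.
move=> FU mA ig JA wA A0 cc' gc'.
have lamA : 0 < fine (lam A) by rewrite fine_gt0// A0 ltey_eq fin_num_measure.
have : 0 < \int[lam]_(x in A) g x - c * fine (lam A).
  rewrite subr_gt0; apply: lt_le_trans (_ : c' * fine (lam A) <= _).
    by rewrite ltr_pM2r.
  rewrite -Rintegral_cst//; apply: le_Rintegral => //.
    exact: (@bounded_integrable _ _ _ lam _ (cst c') `|c'|).
  exact: integrableS ig.
have : J p A - c * w p A @[p --> U] -->
    \int[lam]_(x in A) g x - c * fine (lam A).
  by apply: cvgB => //; apply: cvgMl_tmp.
move=> /cvgr_gt h /h; apply: filterS => p.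
by rewrite subr_gt0.
Qed.

Lemma eventually_lt_of_density (I : Type) (U : set_system I)
    (J w : I -> set T -> R) (g : T -> R) (A : set T) (c c' : R) :
  Filter U -> measurable A ->
  lam.-integrable setT (EFin \o g) ->
  J p A @[p --> U] --> \int[lam]_(x in A) g x ->
  w p A @[p --> U] --> fine (lam A) ->
  (0 < lam A)%E -> c' < c -> (forall x, A x -> g x <= c') ->
  \forall p \near U, J p A < c * w p A.
Proof.
move=> FU mA ig JA wA A0 cc' gc'.
have lamA : 0 < fine (lam A) by rewrite fine_gt0// A0 ltey_eq fin_num_measure.
have : 0 < c * fine (lam A) - \int[lam]_(x in A) g x.
  rewrite subr_gt0; apply: le_lt_trans (_ : _ <= c' * fine (lam A)) _.
    rewrite -Rintegral_cst//; apply: le_Rintegral => //.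
      exact: integrableS ig.
    exact: (@bounded_integrable _ _ _ lam _ (cst c') `|c'|).
  by rewrite ltr_pM2r.
have : c * w p A - J p A @[p --> U] -->
    c * fine (lam A) - \int[lam]_(x in A) g x.
  by apply: cvgB => //; apply: cvgMl_tmp.
move=> /cvgr_gt h /h; apply: filterS => p.
by rewrite subr_gt0.
Qed.

End splitting.

(** * Functions in general position *)

Section gap_dimension_infinite.
Context {d} {T : measurableType d} {R : realType}.
Variables (lam : probability T R) (F : set (T -> R)) (alpha gamma : R).

Definition gap_side (b : bool) (f : T -> R) : set T :=
  if b then [set x | alpha + gamma < f x] else [set x | f x < alpha - gamma].

Fixpoint gap_cell (B : set T) (fs : seq (T -> R)) (bs : bitseq) : set T :=
  match fs, bs with
  | f :: fs', b :: bs' => gap_cell B fs' bs' `&` gap_side b f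
  | _, _ => B
  end.

Lemma gap_cell_sub B fs bs : gap_cell B fs bs `<=` B.
Proof.
by elim: fs bs => [|f fs IHfs] [|b bs] //= x [/IHfs].
Qed.

Lemma gap_cell_nth B f0 fs bs i x : size bs = size fs -> (i < size fs)%N ->
  gap_cell B fs bs x -> gap_side (nth false bs i) (nth f0 fs i) x.
Proof.
elim: fs bs i => [|f fs IHfs] [|b bs] [|i] //= [sz] ifs [] // cx _.
exact: IHfs.
Qed.

Hypothesis measurableF : forall f, F f -> measurable_fun setT f.

Lemma measurable_gap_side b f : F f -> measurable (gap_side b f).
Proof.
move=> /measurableF mf.
by case: b; [exact: measurable_superlevel|exact: measurable_sublevel].
Qed.

Lemma measurable_gap_cell B fs bs : measurable B ->
  {in fs, forall f, F f} -> measurable (gap_cell B fs bs).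
Proof.
move=> mB; elim: fs bs => [|f fs IHfs] [|b bs] //= Ffs.
apply: measurableI.
  by apply: IHfs => g gfs; apply: Ffs; rewrite inE gfs orbT.
by apply: measurable_gap_side; apply: Ffs; rewrite inE eqxx.
Qed.

Variable B : set T.
Hypotheses (mB : measurable B) (B_gt0 : (0 < lam B)%E).
Hypothesis split_cells : forall (I : finType) (A : I -> set T),
  (forall i, [/\ measurable (A i), A i `<=` B & (0 < lam (A i))%E]) ->
  exists2 f, F f & forall i b, (0 < lam (A i `&` gap_side b f))%E.

Lemma exists_gap_independent k : exists fs : seq (T -> R),
  [/\ size fs = k, {in fs, forall f, F f} &
    forall bs, size bs = k -> (0 < lam (gap_cell B fs bs))%E].
Proof.
elim: k => [|k [fs [sz Ffs fsB]]].
  by exists [::]; split => // bs /size0nil ->.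
(* One new function must split all [2 ^ k] existing cells simultaneously, hence the finite index
   type in [split_cells]. *)
have [|f Ff fB] := @split_cells (k.-tuple bool) (fun t => gap_cell B fs t).
  move=> t; split; [exact: measurable_gap_cell|exact: gap_cell_sub|].
  by apply: fsB; rewrite size_tuple.
exists (f :: fs); split => /=; first by rewrite sz.
- by move=> g; rewrite inE => /predU1P[->|/Ffs].
- move=> [//|b bs] [/eqP szb].
  exact: (fB (Tuple szb) b).
Qed.

Hypothesis gamma_gt0 : 0 < gamma.

(* Dual shattering: 2 ^ L functions in general position, indexed by the subsets
   of an L-element set, shatter L points. *)
Lemma shatters_of_gap_independent L :
  exists2 D : set T, (D #= `I_L)%card & shatters gamma F D.
Proof.
have [fs [sz Ffs fsB]] := exists_gap_independent #|{set 'I_L}|.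
(* A point in the cell of this pattern has the function numbered [s] high when [s] contains [j] and
   low otherwise. *)
pose pattern (j : 'I_L) := [seq j \in s | s : {set 'I_L}].
have szp j : size (pattern j) = #|{set 'I_L}| by rewrite size_map cardT.
have /choice[x xP] : forall j, exists x, gap_cell B fs (pattern j) x.
  move=> j; apply/set0P/eqP => c0.
  by have := fsB _ (szp j); rewrite c0 measure0 ltxx.
pose f_ (s : {set 'I_L}) := nth (cst 0) fs (enum_rank s).
have f_side j (s : {set 'I_L}) : gap_side (j \in s) (f_ s) (x j).
  have := @gap_cell_nth B (cst 0) fs (pattern j) (enum_rank s) (x j).
  rewrite szp sz => /(_ erefl (ltn_ord _) (xP j)).
  by rewrite nth_image enum_rankK.
have Ff_ s : F (f_ s) by apply: Ffs; apply: mem_nth; rewrite sz.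
have gap_lt : alpha - gamma < alpha + gamma.
  by rewrite ltrBlDr -addrA ltrDl addr_gt0.
(* For distinct [i] and [j], the function numbered by the singleton of [i] is high at [x i] and low
   at [x j]. *)
have x_inj : injective x.
  move=> i j xij; apply/eqP/negPn/negP => ij.
  have := f_side i [set i]%SET; have := f_side j [set i]%SET.
  rewrite -xij !inE eqxx eq_sym (negbTE ij) /= => h1 h2.
  by have := lt_trans h1 (lt_trans gap_lt h2); rewrite ltxx.
exists (range x).
  apply: card_eq_trans (inj_card_eq (in2W x_inj)) _.
  have <- : val @` [set: 'I_L] = `I_L.
    apply/seteqP; split => [_ [j _ <-] //=|i /= iL].
    by exists (Ordinal iL).
  by rewrite card_eq_sym; apply: inj_card_eq; apply: in2W; exact: val_inj.
exists alpha => D0 D0x.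
exists (f_ [set j | `[< D0 (x j) >]]%SET) => //; split => y.
  move=> D0y; have [j _ xj] := D0x y D0y.
  have := f_side j [set j | `[< D0 (x j) >]]%SET.
  by rewrite inE xj; case: asboolP.
move=> [[j _ <-] nD].
have := f_side j [set j | `[< D0 (x j) >]]%SET.
by rewrite inE; case: asboolP.
Qed.

Lemma gap_dim_infinite : gap_dim gamma F = +oo%E.
Proof.
apply/eqyP => r r0; apply: (@le_trans _ _ (Num.truncn r).+1%:R%:E).
  by rewrite lee_fin ltW// truncnS_gt.
apply: ereal_sup_ubound; exists (Num.truncn r).+1 => //.
exact: shatters_of_gap_independent.
Qed.

End gap_dimension_infinite.

(** * Gap dimension from two separated limit densities *)

Section limit_functionals.
Context {d} {T : measurableType d} {R : realType}.
Variables (lam : probability T R) (F : set (T -> R)).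
Hypothesis measurableF : forall f, F f -> measurable_fun setT f.

(** The two pairs [J, w] and [J', w'] are kept abstract because either the empirical means or the
    expectations may turn out to be the larger ones; the lemma serves both cases with the roles
    exchanged. *)
Lemma gap_dim_of_limits (I : Type) (U : set_system I) (f : I -> T -> R)
    (J w J' w' : I -> set T -> R) (g g' : T -> R) (gamma : R) :
  ProperFilter U -> (forall p, F (f p)) ->
  lam.-integrable setT (EFin \o g) -> lam.-integrable setT (EFin \o g') ->
  (forall A, measurable A ->
    [/\ J p A @[p --> U] --> \int[lam]_(x in A) g x,
        w p A @[p --> U] --> fine (lam A),
        J' p A @[p --> U] --> \int[lam]_(x in A) g' x &
        w' p A @[p --> U] --> fine (lam A)]) ->
  (forall A c, measurable A -> \forall p \near U,
    c * w p A < J p A -> (0 < lam (A `&` [set x | (c < f p x)%R]))%E) ->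
  (forall A c, measurable A -> \forall p \near U,
    J' p A < c * w' p A -> (0 < lam (A `&` [set x | (f p x < c)%R]))%E) ->
  0 < gamma -> 4 * gamma < \int[lam]_x g x - \int[lam]_x g' x ->
  gap_dim gamma F = +oo%E.
Proof.
move=> FU Ff ig ig' lims high low gamma0 gap.
(* The densities are kept [2 * gamma] away from [alpha]: one [gamma] is the gap to be shattered, the
   other is the strict margin needed to pass from limits back to a single [p]. *)
have [|alpha [B [mB B0 Bg Bg']]] :=
  @exists_gap_level _ _ _ lam g g' (2 * gamma) ig ig'.
  by rewrite mulrA -natrM.
apply: (@gap_dim_infinite _ _ _ lam F alpha gamma measurableF B mB B0) => //.
move=> I0 A AB.
(* There are finitely many cells, so their eventual properties hold together and a single [p] serves
   them all. *)
have : \forall p \near U, forall i : I0,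
    (0 < lam (A i `&` gap_side alpha gamma true (f p)))%E /\
    (0 < lam (A i `&` gap_side alpha gamma false (f p)))%E.
  apply: filter_forall => i; have [mA sAB A0] := AB i.
  have [Jg wA Jg' wA'] := lims _ mA.
  have gt_gap : alpha + gamma < alpha + 2 * gamma.
    by rewrite ltrD2l mulr_natl mulr2n ltrDl.
  have lt_gap : alpha - 2 * gamma < alpha - gamma.
    by rewrite ltrD2l ltrN2 mulr_natl mulr2n ltrDl.
  have hi := eventually_gt_of_density FU mA ig Jg wA A0 gt_gap
    (fun x Ax => Bg x (sAB x Ax)).
  have lo := eventually_lt_of_density FU mA ig' Jg' wA' A0 lt_gap
    (fun x Ax => Bg' x (sAB x Ax)).
  apply: filterS2 (filterI hi (high _ (alpha + gamma) mA))
    (filterI lo (low _ (alpha - gamma) mA)) => p [h hh] [l ll].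
  by split; [exact: hh|exact: ll].
move=> /filter_ex[p fp]; exists (f p) => // i [].
  by have [] := fp i.
by have [] := fp i.
Qed.

End limit_functionals.

(** * Empirical means *)

Lemma measure_gt0_of_Rintegral {d} {T : measurableType d} {R : realType}
    (lam : {measure set T -> \bar R}) (A : set T) (h : T -> R) :
  measurable A -> measurable_fun setT h -> lam.-integrable A (EFin \o h) ->
  0 < \int[lam]_(x in A) h x -> (0 < lam (A `&` [set x | (0 < h x)%R]))%E.
Proof.
move=> mA mh ih; rewrite !ltNge; apply: contra => lam0.
set N := A `&` _ in lam0.
have mN : measurable N.
  by apply: measurableI => //; exact: measurable_superlevel.
have N0 : lam N = 0%E by apply/eqP; rewrite eq_le lam0 measure_ge0.
have -> : \int[lam]_(x in A) h x = \int[lam]_(x in A `\` N) h x.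
  by congr fine; exact: negligible_integral.
have mAN : measurable (A `\` N) by exact: measurableD.
have -> : 0 = \int[lam]_(x in A `\` N) 0 :> R by rewrite Rintegral_cst// mul0r.
apply: le_Rintegral => //; [|exact: integrable0|].
  by apply: integrableS ih => //; exact: subDsetl.
by move=> x [Ax Nx]; rewrite leNgt; apply/negP => hx; exact: Nx.
Qed.

Lemma indic_additive {T : Type} {R : pzRingType} (A B : set T) (x : T) :
  A `&` B = set0 -> \1_(A `|` B) x = \1_A x + \1_B x :> R.
Proof.
move=> AB; rewrite !indicE in_setU.
have [xA|xA] := boolP (x \in A); have [xB|xB] := boolP (x \in B);
  rewrite ?addr0 ?add0r//.
by have : (A `&` B) x; [split; exact: set_mem|rewrite AB].
Qed.

Section empirical.
Context {d d'} {Omega : measurableType d} {T : measurableType d'}.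
Context {R : realType}.
Variables (P : probability Omega R) (X : nat -> {RV P >-> T}).

Let lam : probability T R := distribution P (X 0%N).

Definition empirical (h : T -> R) (p : Omega * nat) : R :=
  p.2%:R^-1 * (\sum_(i < p.2) h (X i p.1)).

Lemma empirical_additive h h' p :
  empirical (fun x => h x + h' x) p = empirical h p + empirical h' p.
Proof. by rewrite /empirical big_split/= mulrDr. Qed.

Lemma le_empirical h h' p :
  (forall x, h x <= h' x) -> empirical h p <= empirical h' p.
Proof. by move=> hh'; rewrite ler_wpM2l// ler_sum. Qed.

Lemma empiricalZ c h p : empirical (fun x => c * h x) p = c * empirical h p.
Proof. by rewrite /empirical -mulr_sumr mulrCA. Qed.

Lemma norm_empirical h p : `|empirical h p| <= empirical (fun x => `|h x|) p.
Proof.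
by rewrite normrM ger0_norm ?invr_ge0// ler_wpM2l// ler_norm_sum.
Qed.

Lemma empirical_indic_le1 A p : empirical \1_A p <= 1.
Proof.
(* At [m = 0] the sum is empty and the empirical mean is 0. *)
case: p => w [|m]; rewrite /empirical /= ?big_ord0 ?mulr0//.
rewrite ler_pdivrMl// mulr1; apply: (@le_trans _ _ (\sum_(i < m.+1) 1)).
  by apply: ler_sum => i _; rewrite indicE lern1 leq_b1.
by rewrite sumr_const card_ord.
Qed.

Lemma empirical_gt0 h p : 0 < empirical h p -> exists i, 0 < h (X i p.1).
Proof.
move=> h0; apply: contrapT => nh; move: h0; apply/negP; rewrite -leNgt.
rewrite mulr_ge0_le0// sumr_le0// => i _.
by rewrite leNgt; apply/negP => hi; apply: nh; exists i.
Qed.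

(** The threshold on [m] may depend on [w]. This turns almost sure convergence into convergence
    along one proper filter, which can then be refined to an ultrafilter. *)
Definition ae_eventually : set_system (Omega * nat) :=
  [set Q | {ae P, forall w, \forall m \near \oo, Q (w, m)}].

Instance ae_eventually_filter : ProperFilter ae_eventually.
Proof.
have PT : (0 < P setT)%E by rewrite probability_setT lte01.
have aeF := ae_properfilter_algebraOfSetsType PT.
split.
  move=> /(@filter_ex _ _ aeF)[w].
  by case=> n _ /(_ n (leqnn n)).
split.
- by apply: aeW => w; exact: filterT.
- move=> A B; apply: (@filterS2 _ (almost_everywhere P)) => w.
  exact: filterI.
- move=> A B AB; apply: (@filterS _ (almost_everywhere P)) => w.
  by apply: filterS => m; exact: AB.
Qed.

Lemma Rintegral_distribution (f : T -> R) (K : R) :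
  measurable_fun setT f -> (forall x, `|f x| <= K) ->
  \int[lam]_x f x = \int[P]_w f (X 0%N w).
Proof.
move=> mf fK; congr fine; rewrite integral_pushforward ?preimage_setT//.
- exact/measurable_EFinP.
- apply: (@bounded_integrable _ _ _ P setT (f \o X 0%N) K) => //.
    exact: measurableT_comp.
  by move=> w; exact: fK.
Qed.

Hypotheses (stationaryX : stationary P X) (ergodicX : ergodic P X).

Lemma empirical_cvg (h : T -> R) (K : R) : measurable_fun setT h ->
  (forall x, `|h x| <= K) ->
  empirical h p @[p --> ae_eventually] --> \int[lam]_x h x.
Proof.
move=> mh hK; apply/cvgrPdist_lt => e e0.
rewrite (Rintegral_distribution mh hK).
apply: filterS (birkhoff_process stationaryX ergodicX mh hK e0) => w.
by apply: filterS => m; rewrite distrC.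
Qed.

(** By stationarity each [X i] has law [lam], so it hits a given null set with probability 0. There
    are countably many pairs of a time and a null member of [D]. *)
Lemma ae_visits (D : set (set T)) : countable D ->
  (forall B, D B -> measurable B) ->
  {ae P, forall w, forall i B, D B -> B (X i w) -> (0 < lam B)%E}.
Proof.
move=> /countable_injP[code codeI] mD.
(* Quantifying over codes [n] instead of sets reduces the claim to countable intersections indexed
   by natural numbers. *)
suff : {ae P, forall w, forall i n B,
    D B -> code B = n -> B (X i w) -> (0 < lam B)%E}.
  by apply: filterS => w h i B DB; exact: h DB erefl.
apply/ae_foralln => i; apply/ae_foralln => n.
have [[B [DB Bn]]|noB] := pselect (exists B, D B /\ code B = n); last first.
  by apply: aeW => w B DB Bn; case: noB; exists B.
have uniqB B' : D B' -> code B' = n -> B' = B.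
  by move=> DB' B'n; apply: codeI; rewrite ?inE// B'n.
have [lamB|] := ltP 0%E (lam B).
  by apply: aeW => w B' DB' /(uniqB _ DB') ->.
move=> lamB0; have mB := mD _ DB.
exists (X i @^-1` B); split.
- by rewrite -[X in measurable X]setTI; exact: measurable_funP.
- apply: (etrans (stationary_distribution stationaryX i mB)).
  by apply: le_anti; rewrite lamB0/=.
move=> w /= nw; apply: contrapT => XB; apply: nw => B' DB' B'n.
by rewrite (uniqB _ DB' B'n).
Qed.


(** * Discrepancy of a countable bounded family *)

Variable F : set (T -> R).
Hypotheses (countableF : countable F)
  (measurableF : forall f, F f -> measurable_fun setT f).
Variable M : R.
Hypothesis boundedF : forall f, F f -> forall x, `|f x| <= M.

Lemma discrepancy_witness (c eta : R) : is_asymptotic_discrepancy P X F c ->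
  0 < eta -> eta < c -> \forall p \near ae_eventually, exists2 f, F f &
    eta < `|empirical f p - \int[lam]_x f x|.
Proof.
move=> Fc eta0 etac; apply: filterS Fc => w Fw.
have near_gt : \forall m \near \oo, eta < discrepancy P X F m w.
  exact: cvgr_gt Fw _ etac.
apply: filterS near_gt => m; rewrite /discrepancy; set S := [set _ | _ in F].
(* The supremum of the empty set is 0 by convention, which cannot exceed the positive [eta]. *)
have [->|/set0P S0] := eqVneq S set0.
  by rewrite sup0 => /(lt_trans eta0); rewrite ltxx.
move=> /(sup_gt S0)[_ [f Ff <-]] etaf; exists f => //.
have -> // : \int[lam]_x f x = fine 'E_P[f \o X 0%N].
by rewrite unlock (Rintegral_distribution (measurableF Ff) (boundedF Ff)).
Qed.

(** A positive mean of [(f p - c) * \1_A] forces some [X i] to visit the part of [A] where [f p]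
    exceeds [c]. Since [f p] varies with [p], the null sets to be avoided are those arising from all
    of [F]; countability of [F] enters here. *)
Lemma high_visits (U : set_system (Omega * nat))
    (f : Omega * nat -> T -> R) A c :
  Filter U -> ae_eventually `<=` U -> (forall p, F (f p)) -> measurable A ->
  \forall p \near U,
    c * empirical \1_A p < empirical (fun x => f p x * \1_A x) p ->
    (0 < lam (A `&` [set x | (c < f p x)%R]))%E.
Proof.
move=> FU sU Ff mA; apply: sU.
have : {ae P, forall w, forall i B,
    [set A `&` [set x | (c < f x)%R] | f in F] B ->
    B (X i w) -> (0 < lam B)%E}.
  apply: ae_visits; first exact: sub_countable (card_image_le _ _) countableF.
  move=> _ [g Fg <-]; apply: measurableI => //.
  exact/measurable_superlevel/measurableF.
apply: filterS => w visits; apply: nearW => m.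
rewrite -subr_gt0 -mulNr -empiricalZ -empirical_additive => /empirical_gt0[i].
rewrite -mulrDl indicE; have [Ai|] := boolP (X i _ \in A); last first.
  by rewrite mulr0 ltxx.
rewrite mulr1 subr_gt0 => cf; apply: visits; first by exists (f (w, m)).
by split; [exact: set_mem Ai|exact: cf].
Qed.

Lemma low_visits (U : set_system (Omega * nat))
    (f : Omega * nat -> T -> R) A c :
  Filter U -> ae_eventually `<=` U -> (forall p, F (f p)) -> measurable A ->
  \forall p \near U,
    empirical (fun x => f p x * \1_A x) p < c * empirical \1_A p ->
    (0 < lam (A `&` [set x | (f p x < c)%R]))%E.
Proof.
move=> FU sU Ff mA; apply: sU.
have : {ae P, forall w, forall i B,
    [set A `&` [set x | (f x < c)%R] | f in F] B ->
    B (X i w) -> (0 < lam B)%E}.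
  apply: ae_visits; first exact: sub_countable (card_image_le _ _) countableF.
  move=> _ [g Fg <-]; apply: measurableI => //.
  exact/measurable_sublevel/measurableF.
apply: filterS => w visits; apply: nearW => m.
rewrite -subr_gt0 -[X in _ - X]mul1r -mulNr -!empiricalZ -empirical_additive.
move=> /empirical_gt0[i].
rewrite mulN1r -mulrBl indicE; have [Ai|] := boolP (X i _ \in A); last first.
  by rewrite mulr0 ltxx.
rewrite mulr1 subr_gt0 => cf; apply: visits; first by exists (f (w, m)).
by split; [exact: set_mem Ai|exact: cf].
Qed.

(** The counterpart of [high_visits] for expectations: [f - c] has a positive integral over [A]. *)
Lemma high_integral f A c : F f -> measurable A ->
  c * fine (lam A) < \int[lam]_(x in A) f x ->
  (0 < lam (A `&` [set x | (c < f x)%R]))%E.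
Proof.
move=> Ff mA cf.
have mfc : measurable_fun setT (fun x => f x - c).
  by apply: measurable_funB => //; exact: measurableF.
have fcM x : `|f x - c| <= M + `|c|.
  by rewrite (le_trans (ler_normB _ _))// lerD// boundedF.
have ifA : lam.-integrable A (EFin \o f).
  exact: bounded_integrable mA (measurableF Ff) (boundedF Ff).
have icA : lam.-integrable A (EFin \o cst c).
  exact: (@bounded_integrable _ _ _ lam _ (cst c) `|c|).
have := @measure_gt0_of_Rintegral _ _ _ lam A _ mA mfc
  (bounded_integrable lam mA mfc fcM).
rewrite RintegralB// Rintegral_cst// subr_gt0 => /(_ cf).
by under eq_set do rewrite subr_gt0.
Qed.

Lemma low_integral f A c : F f -> measurable A ->
  \int[lam]_(x in A) f x < c * fine (lam A) ->
  (0 < lam (A `&` [set x | (f x < c)%R]))%E.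
Proof.
move=> Ff mA cf.
have mfc : measurable_fun setT (fun x => c - f x).
  by apply: measurable_funB => //; exact: measurableF.
have fcM x : `|c - f x| <= `|c| + M.
  by rewrite (le_trans (ler_normB _ _))// lerD// boundedF.
have ifA : lam.-integrable A (EFin \o f).
  exact: bounded_integrable mA (measurableF Ff) (boundedF Ff).
have icA : lam.-integrable A (EFin \o cst c).
  exact: (@bounded_integrable _ _ _ lam _ (cst c) `|c|).
have := @measure_gt0_of_Rintegral _ _ _ lam A _ mA mfc
  (bounded_integrable lam mA mfc fcM).
rewrite RintegralB// Rintegral_cst// subr_gt0 => /(_ cf).
by under eq_set do rewrite subr_gt0.
Qed.


Lemma gap_dim_of_discrepancy (c eta gamma : R) :
  is_asymptotic_discrepancy P X F c -> 0 < eta -> eta < c ->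
  0 < gamma -> 4 * gamma < eta -> gap_dim gamma F = +oo%E.
Proof.
move=> Fc eta0 etac gamma0 gamma_eta.
have witness := discrepancy_witness Fc eta0 etac.
have [_ [f0 Ff0 _]] := filter_ex witness.
have M0 : 0 <= M := le_trans (normr_ge0 _) (boundedF Ff0 point).
(* The selection is made total by the default [f0] at the pairs without a witness; these pairs are
   negligible for [ae_eventually]. *)
have /choice[f fP] : forall p, exists f, F f /\
    ((exists2 f, F f & eta < `|empirical f p - \int[lam]_x f x|) ->
     eta < `|empirical f p - \int[lam]_x f x|).
  move=> p; have [[f Ff ef]|nf] := pselect (exists2 f, F f &
    eta < `|empirical f p - \int[lam]_x f x|); first by exists f.
  by exists f0; split => // /nf.
have Ff p : F (f p) by have [] := fP p.
(* Along an ultrafilter the bounded quantities [J p A] and [J' p A] converge for all measurable [A]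
   at once, although [f p] itself need not converge in any sense. *)
have [U [UU sU]] := @ultraFilterLemma _ _ ae_eventually_filter.
pose J (p : Omega * nat) A := empirical (fun x => f p x * \1_A x) p.
pose w (p : Omega * nat) A := empirical \1_A p.
pose J' (p : Omega * nat) A := \int[lam]_(x in A) f p x.
pose w' (p : Omega * nat) A := fine (lam A).
have iF p A : measurable A -> lam.-integrable A (EFin \o f p).
  move=> mA.
  exact: bounded_integrable mA (measurableF (Ff p)) (boundedF (Ff p)).
have wU A : measurable A -> w p A @[p --> U] --> fine (lam A).
  move=> mA.
  have -> : fine (lam A) = \int[lam]_x \1_A x.
    by rewrite /Rintegral integral_indic// setIT.
  apply: cvg_trans (_ : empirical \1_A p @[p --> ae_eventually] --> _).
    by move=> V; exact: sU.
  apply: (@empirical_cvg _ 1) => // x.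
  by rewrite indicE ger0_norm// lern1 leq_b1.
have w'U A : measurable A -> w' p A @[p --> U] --> fine (lam A).
  by move=> _; exact: cvg_cst.
have [g ig JU] : exists2 g : T -> R, lam.-integrable setT (EFin \o g) &
    forall A, measurable A -> J p A @[p --> U] --> \int[lam]_(x in A) g x.
  apply: (@limit_density _ _ _ lam _ U J w M UU M0) => //.
  - move=> p A B mA mB AB; rewrite /J -empirical_additive; congr empirical.
    by apply/funext => x; rewrite indic_additive// mulrDr.
  - move=> p A mA; rewrite /J /w -empiricalZ.
    apply: le_trans (norm_empirical _ _) _; apply: le_empirical => x.
    rewrite normrM [X in _ * X]ger0_norm ?indicE//.
    by rewrite ler_wpM2r// boundedF.
  - by move=> p A mA; exact: empirical_indic_le1.
have [g' ig' JU'] : exists2 g : T -> R, lam.-integrable setT (EFin \o g) &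
    forall A, measurable A -> J' p A @[p --> U] --> \int[lam]_(x in A) g x.
  apply: (@limit_density _ _ _ lam _ U J' w' M UU M0) => //.
  - move=> p A B mA mB /eqP AB; rewrite /J' Rintegral_setU//.
    by apply: iF; exact: measurableU.
  - move=> p A mA; rewrite /J' /w' -Rintegral_cst//.
    apply: le_trans (le_normr_Rintegral _ _) _ => //; first exact: iF.
    apply: le_Rintegral => //.
    + exact: integrable_abse (iF p A mA).
    + apply: (@bounded_integrable _ _ _ lam _ (cst M) M) => // x.
      by rewrite ger0_norm.
    + by move=> x _; exact: boundedF.
  - move=> p A mA; rewrite /w' -lee_fin.
    by rewrite fineK ?probability_le1// fin_num_measure.
have lims A : measurable A -> [/\ J p A @[p --> U] --> \int[lam]_(x in A) g x,
    w p A @[p --> U] --> fine (lam A),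
    J' p A @[p --> U] --> \int[lam]_(x in A) g' x &
    w' p A @[p --> U] --> fine (lam A)].
  by move=> mA; split; [exact: JU|exact: wU|exact: JU'|exact: w'U].
(* The strict inequality at each witness becomes a weak one in the limit; strictness returns with
   [4 * gamma < eta]. *)
have gap : eta <= `|\int[lam]_x g x - \int[lam]_x g' x|.
  have h : `|J p setT - J' p setT| @[p --> U] -->
      `|\int[lam]_x g x - \int[lam]_x g' x|.
    by apply: cvg_norm; apply: cvgB; [exact: JU|exact: JU'].
  rewrite -(cvg_lim _ h)//; apply: limr_ge; first exact: cvgP h.
  have : U (fun p => exists2 f, F f & eta < `|empirical f p - \int[lam]_x f x|).
    exact: sU.
  apply: filterS => p /(proj2 (fP p)) /ltW.
  rewrite /J /J'; congr (_ <= `|_ - _|); congr empirical.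
  by apply/funext => x; rewrite indicT mulr1.
(* The sign of the discrepancy may change with [p], but its limit has a fixed sign, which decides
   whether empirical means or expectations supply the high side. *)
have [gg'|gg'] := leP 0 (\int[lam]_x g x - \int[lam]_x g' x).
  rewrite ger0_norm// in gap.
  apply: (@gap_dim_of_limits _ _ _ lam F measurableF _ U f J w J' w' g g') =>
    //.
  - by move=> A k mA; exact: high_visits.
  - by move=> A k mA; apply: filterE => p; exact: low_integral.
  - exact: lt_le_trans gap.
rewrite ltr0_norm// opprB in gap.
apply: (@gap_dim_of_limits _ _ _ lam F measurableF _ U f J' w' J w g' g) => //.
- by move=> A mA; have [] := lims A mA.
- by move=> A k mA; apply: filterE => p; exact: high_integral.
- by move=> A k mA; exact: low_visits.
- exact: lt_le_trans gap.
Qed.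

End empirical.

Theorem theorem1 (R : realType) (T : completeMetricType R)
    (separableT : separable T)
    (F : set (T -> R)) (countableF : countable F)
    (measurableF : forall f, F f -> measurable_fun setT (f : borel T -> R))
    (boundedF : exists M : R, forall f, F f -> forall x, `|f x| <= M)
    (d : measure_display) (Omega : measurableType d) (P : probability Omega R)
    (X : nat -> {RV P >-> borel T})
    (stationaryX : stationary P X) (ergodicX : ergodic P X)
    (eta : R) (eta_gt0 : 0 < eta)
    (discrepancyF : eta < asymptotic_discrepancy P X F)
    (gamma : R) (gamma_gt0 : 0 < gamma) (gamma_le : gamma <= eta / 10) :
  gap_dim gamma F = +oo%E.
Proof.
have [M FM] := boundedF.
move: discrepancyF; rewrite /asymptotic_discrepancy.
(* Without an almost sure limit the asymptotic discrepancy would be the dummy value 0, contradicting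
   [0 < eta]. *)
case: xgetP => [c _ Fc etac|_]; last first.
  by move=> /(lt_trans eta_gt0); rewrite ltxx.
apply: (gap_dim_of_discrepancy stationaryX ergodicX countableF measurableF FM Fc
  eta_gt0 etac gamma_gt0).
lra.
Qed.
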